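(* Let $$P_{+}(\mathbf{x},\mathbf{y}) = x_1^2 y_1^2 + x_2^2 y_2^2 + x_3^2 y_3^2 + x_1^2 y_2^2 + x_2^2 y_3^2 + x_3^2 y_1^2 + (x_1y_3+x_2y_1)^2 .$$ Then $\operatorname{sos}(P_{+})\le 6$.
   Context: Here $\mathbf{x}=(x_1,x_2,x_3)$ and $\mathbf{y}=(y_1,y_2,y_3)$ are real variables. A bilinear form is a polynomial $\sum_{i,j} c_{ij}x_iy_j$ with real coefficients. A biquadratic form $P$ (a real linear combination of monomials $x_ix_ky_jy_l$) is SOS if it is a finite sum of squares of bilinear forms; its SOS rank $\operatorname{sos}(P)$ is the smallest number of squares of bilinear forms in such a representation. *)

(* Defs.v *)
From mathcomp Require Import all_boot all_order all_algebra.
From mathcomp Require Import boolp reals.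
From mathcomp.multinomials Require Import mpoly.

Set Implicit Arguments.
Unset Strict Implicit.
Unset Printing Implicit Defensive.

Import GRing.Theory.
Local Open Scope ring_scope.

Section Biquadratic.
Variable R : realType.

(* R[x_1, x_2, x_3, y_1, y_2, y_3]: the first block of three variables is x,
   the second is y, both indexed from 0. *)
Definition xvar (i : 'I_3) : {mpoly R[3 + 3]} := 'X_(lshift 3 i).
Definition yvar (j : 'I_3) : {mpoly R[3 + 3]} := 'X_(rshift 3 j).

Definition is_bilinear (L : {mpoly R[3 + 3]}) : Prop :=
  exists c : 'I_3 -> 'I_3 -> R,
    L = \sum_(i < 3) \sum_(j < 3) c i j *: (xvar i * yvar j).

Definition is_biquadratic (P : {mpoly R[3 + 3]}) : Prop :=
  exists c : 'I_3 -> 'I_3 -> 'I_3 -> 'I_3 -> R,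
    P = \sum_(i < 3) \sum_(k < 3) \sum_(j < 3) \sum_(l < 3)
          c i k j l *: (xvar i * xvar k * (yvar j * yvar l)).

Definition sum_of_squares (P : {mpoly R[3 + 3]}) (r : nat) : Prop :=
  exists2 L : 'I_r -> {mpoly R[3 + 3]},
    forall t, is_bilinear (L t) & P = \sum_(t < r) L t ^+ 2.

Definition is_sos (P : {mpoly R[3 + 3]}) : Prop :=
  is_biquadratic P /\ exists r, sum_of_squares P r.

Lemma sos_lengths (P : {mpoly R[3 + 3]}) :
  is_sos P -> exists r, `[< sum_of_squares P r >].
Proof. by case=> _ [r Pr]; exists r; apply/asboolP. Qed.

(* The rank is only defined for an SOS form, so it takes a proof of [is_sos];
   [ex_minn] returns the least length. *)
Definition sos_rank (P : {mpoly R[3 + 3]}) (sosP : is_sos P) : nat :=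
  ex_minn (sos_lengths sosP).

Definition Pplus : {mpoly R[3 + 3]} :=
  let x1 := xvar (inord 0) in let x2 := xvar (inord 1) in
  let x3 := xvar (inord 2) in
  let y1 := yvar (inord 0) in let y2 := yvar (inord 1) in
  let y3 := yvar (inord 2) in
  x1 ^+ 2 * y1 ^+ 2 + x2 ^+ 2 * y2 ^+ 2 + x3 ^+ 2 * y3 ^+ 2
  + x1 ^+ 2 * y2 ^+ 2 + x2 ^+ 2 * y3 ^+ 2 + x3 ^+ 2 * y1 ^+ 2
  + (x1 * y3 + x2 * y1) ^+ 2.

End Biquadratic.

(* Main.v *)
Require Import Defs.
From mathcomp Require Import all_boot all_order all_algebra.
From mathcomp Require Import boolp reals.
From mathcomp.multinomials Require Import mpoly.
From mathcomp Require Import ring.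

Set Implicit Arguments.
Unset Strict Implicit.
Unset Printing Implicit Defensive.

Import Order.TTheory GRing.Theory Num.Theory.
Local Open Scope ring_scope.

(** Write [z_ij] for [x_i y_j].  As it stands, [Pplus] is a sum of seven
    squares.  Other sums of squares come from the freedom to move multiples of
    the relations [z_ij z_kl = z_il z_kj] (the 2x2 minors of the matrix
    [x^T y]) in and out of the Gram matrix of the form in the [z_ij]; the
    number of squares is the rank of a positive semidefinite Gram matrix.

    The square [z_32 ^ 2] does not occur in [Pplus], so a positive semidefinite
    Gram matrix has a zero row at [z_32].  This leaves an 8x8 matrix with unit
    diagonal and five free entries
<<
      a = z_11.z_22 = - z_12.z_21      b = z_11.z_23 = 1 - z_13.z_21
      c = z_12.z_23 = - z_13.z_22      d = z_11.z_33 = - z_13.z_31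
      e = z_21.z_33 = - z_23.z_31
>>
    all other off-diagonal entries being zero.  The variables
    [z_31, z_33, z_12, z_22] are mutually orthogonal unit vectors, and
    completing the square in each of them splits off four squares and leaves a
    4x4 matrix in [z_11, z_21, z_13, z_23].  For [b = 1/2], [d = e],
    [c = - a] this matrix is invariant under the Klein four-group generated by
    exchanging the [x]-indices 1, 2 and exchanging the [y]-indices 1, 3, so the
    four sign characters diagonalize it, with eigenvalues
<<
      (+,+)  3/2 - 2 d^2 - 2 a^2       (+,-)  1/2 - 2 d^2
      (-,-)  3/2                       (-,+)  1/2 - 2 a^2
>>
    At [a = d = 1/2] two of them vanish and the other two are [1/2] and [3/2]:
    the remainder has rank 2, and [4 + 2 = 6] squares suffice.  The resulting
    identity is [Pplus_identity].  Any sum of squares of bilinear forms is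
    biquadratic ([sum_of_squares_is_sos]), so this one decomposition both shows
    that the rank is defined and bounds it. *)

Section SixSquares.
Variable R : realType.
Implicit Types (L M P : {mpoly R[3 + 3]}).

Lemma bilinear_monomial i j : is_bilinear (xvar R i * yvar R j).
Proof.
exists (fun k l => ((k == i) && (l == j))%:R).
rewrite (bigD1 i) //= (bigD1 j) //= !eqxx scale1r big1 ?addr0; last first.
  by move=> l /negPf ->; rewrite scale0r.
rewrite big1 ?addr0 // => k /negPf ->.
by rewrite big1 // => l _; rewrite scale0r.
Qed.

Lemma bilinearD L M : is_bilinear L -> is_bilinear M -> is_bilinear (L + M).
Proof.
move=> [c ->] [d ->]; exists (fun i j => c i j + d i j).
rewrite -big_split; apply: eq_bigr => i _ /=.
by rewrite -big_split; apply: eq_bigr => j _ /=; rewrite scalerDl.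
Qed.

Lemma bilinearZ (a : R) L : is_bilinear L -> is_bilinear (a%:MP * L).
Proof.
move=> [c ->]; exists (fun i j => a * c i j).
rewrite mul_mpolyC scaler_sumr; apply: eq_bigr => i _.
by rewrite scaler_sumr; apply: eq_bigr => j _; rewrite scalerA.
Qed.

Lemma bilinearN L : is_bilinear L -> is_bilinear (- L).
Proof. by rewrite -mulN1r -mpolyC1 -mpolyCN; apply: bilinearZ. Qed.

Lemma bilinearM_biquadratic L M :
  is_bilinear L -> is_bilinear M -> is_biquadratic (L * M).
Proof.
move=> [c ->] [d ->]; exists (fun i k j l => c i j * d k l).
rewrite big_distrlr; apply: eq_bigr => i _; apply: eq_bigr => k _ /=.
rewrite big_distrlr; apply: eq_bigr => j _; apply: eq_bigr => l _ /=.
by rewrite -scalerAl -scalerAr scalerA mulrACA.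
Qed.

Lemma biquadratic0 : is_biquadratic (0 : {mpoly R[3 + 3]}).
Proof.
exists (fun _ _ _ _ => 0).
by do 4![rewrite big1 // => ? _]; rewrite scale0r.
Qed.

Lemma biquadraticD P Q :
  is_biquadratic P -> is_biquadratic Q -> is_biquadratic (P + Q).
Proof.
move=> [c ->] [d ->]; exists (fun i k j l => c i k j l + d i k j l).
do 4![rewrite -big_split; apply: eq_bigr => ? _ /=].
by rewrite scalerDl.
Qed.

Lemma sum_of_squares_is_sos P r : sum_of_squares P r -> is_sos P.
Proof.
move=> sosP; split; last by exists r.
case: sosP => L bilL ->.
elim/big_ind: _ => [||t _]; first exact: biquadratic0.
  exact: biquadraticD.
by rewrite expr2; apply: bilinearM_biquadratic.
Qed.

Lemma sos_rank_le P r (sosP : is_sos P) :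
  sum_of_squares P r -> (sos_rank sosP <= r)%N.
Proof.
by rewrite /sos_rank => Pr; case: ex_minnP => m _; apply; apply/asboolP.
Qed.

(** The four completed squares come first; the last two are the eigenvectors of
    the remaining 4x4 matrix.  An eigenvalue [m] on the sign vector [v] of
    length 2 contributes [(m / 4) (v.z) ^ 2], hence the weights
    [(1/2) / 4 = h ^ 3] and [(3/2) / 4 = 3 h ^ 3] at [h = 1/2]. *)
Lemma Pplus_identity (A : comNzRingType) (h s t x1 x2 x3 y1 y2 y3 : A) :
    h *+ 2 = 1 -> s ^+ 2 = h ^+ 3 -> t ^+ 2 = 3 * h ^+ 3 ->
  x1 ^+ 2 * y1 ^+ 2 + x2 ^+ 2 * y2 ^+ 2 + x3 ^+ 2 * y3 ^+ 2
  + x1 ^+ 2 * y2 ^+ 2 + x2 ^+ 2 * y3 ^+ 2 + x3 ^+ 2 * y1 ^+ 2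
  + (x1 * y3 + x2 * y1) ^+ 2
  = (x3 * y1 - h * (x1 * y3 + x2 * y3)) ^+ 2
    + (x3 * y3 + h * (x1 * y1 + x2 * y1)) ^+ 2
    + (x1 * y2 - h * (x2 * y1 + x2 * y3)) ^+ 2
    + (x2 * y2 + h * (x1 * y1 + x1 * y3)) ^+ 2
    + (s * (x1 * y1 + x2 * y1 + x1 * y3 + x2 * y3)) ^+ 2
    + (t * (x1 * y1 - x2 * y1 - x1 * y3 + x2 * y3)) ^+ 2.
Proof.
move=> h2 s2 t2; rewrite ![(s * _) ^+ 2]exprMn ![(t * _) ^+ 2]exprMn s2 t2.
(* The coefficients that remain, [4 h^3 + 2 h^2 - 1], [2 h^2 - 4 h^3] and
   [16 h^3 - 2], are the multiples of [2 h - 1] collected here. *)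
apply/esym/subr0_eq; transitivity ((h *+ 2 - 1) *
    ((2 * h ^+ 2 + 2 * h + 1) * ((x1 ^+ 2 + x2 ^+ 2) * (y1 ^+ 2 + y3 ^+ 2))
     - 2 * h ^+ 2 * ((x1 ^+ 2 + x2 ^+ 2) * (y1 * y3)
                     + x1 * x2 * (y1 ^+ 2 + y3 ^+ 2))
     + 2 * (4 * h ^+ 2 + 2 * h + 1) * (x1 * x2 * (y1 * y3)))).
  by ring.
by rewrite h2 subrr mul0r.
Qed.

Lemma Pplus_six_squares : sum_of_squares (Pplus R) 6.
Proof.
pose h : R := 2^-1.
pose s := Num.sqrt (h ^+ 3); pose t := Num.sqrt (3 * h ^+ 3).
have h0 : 0 <= h by rewrite invr_ge0 ler0n.
have h2 : h *+ 2 = 1 by rewrite -mulr_natr mulVf // pnatr_eq0.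
have s2 : s ^+ 2 = h ^+ 3 by rewrite sqr_sqrtr // exprn_ge0.
have t2 : t ^+ 2 = 3 * h ^+ 3.
  by rewrite sqr_sqrtr // mulr_ge0 ?exprn_ge0 ?ler0n.
(* Indices start at 0: [z 2 0] is [z_31]. *)
pose z (i j : nat) := xvar R (inord i) * yvar R (inord j).
have bz i j : is_bilinear (z i j) by exact: bilinear_monomial.
pose L := [:: z 2 0 - h%:MP * (z 0 2 + z 1 2); z 2 2 + h%:MP * (z 0 0 + z 1 0);
              z 0 1 - h%:MP * (z 1 0 + z 1 2); z 1 1 + h%:MP * (z 0 0 + z 0 2);
              s%:MP * (z 0 0 + z 1 0 + z 0 2 + z 1 2);
              t%:MP * (z 0 0 - z 1 0 - z 0 2 + z 1 2)].
exists (fun k : 'I_6 => L`_k).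
  case=> [[|[|[|[|[|[|//]]]]]] lt_k6]; rewrite /L /=;
    by do ![exact: bz | apply: bilinearD | apply: bilinearN | apply: bilinearZ].
rewrite !big_ord_recl big_ord0 addr0 /= !addrA.
apply: Pplus_identity; first by rewrite -mpolyCMn h2.
  by rewrite -!rmorphXn s2.
by rewrite -!rmorphXn t2 rmorphM rmorph_nat.
Qed.

End SixSquares.

Theorem proposition4p1 (R : realType) :
  exists sosP : is_sos (Pplus R), (sos_rank sosP <= 6)%N.
Proof.
exists (sum_of_squares_is_sos (Pplus_six_squares R)).
exact/sos_rank_le/Pplus_six_squares.
Qed.
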